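(* Let $m \geq 2$ and let $S = \{s_1,\ldots,s_\ell\}$ be a nonempty set of positive integers that is a sum-free Sidon set modulo $m$. Let $A = \{um+s : u \geq 0,\ s \in S\}$; every $a \in A$ has a unique representation $a = u(a)m + s(a)$ with $u(a) \geq 0$ an integer and $s(a) \in S$. For a positive integer $n$, let $\mathcal{A}(n)$ be the set of partitions of $n$ of the form $n = a_1 + \cdots + a_k$ with $a_i \in A$ and $u(a_1) > u(a_2) > \cdots > u(a_k) \geq 0$, and let $p_{\mathcal{A}}(n) = |\mathcal{A}(n)|$. Let $B = \{vm + s + s' : v \geq 1,\ s, s' \in S\}$, $B' = \{vm + s + s' : v \geq 1,\ s, s' \in S,\ s \neq s'\}$, and $H = A \cup B$. Every $h \in H$ can be written uniquely as $h = v(h)m + t(h)$ with $v(h) \geq 0$ an integer and $t(h) \in S \cup 2S$, where $2S = \{s+s' : s,s' \in S\}$. Let $\mathcal{H}(n)$ be the set of partitions $\pi' = (h_1,\ldots,h_d)$ of $n$ (i.e. $h_1+\cdots+h_d = n$), with parts listed in the order given by the following conditions, such that $h_i \in H$ for $i=1,\ldots,d$, $v(h_i) - v(h_{i+1}) \geq 3$ for $i = 1,\ldots,d-1$, and $v(h_i) - v(h_{i+1}) \geq 4$ whenever $h_{i+1} \in B$. For $\pi' = (h_1,\ldots,h_d) \in \mathcal{H}(n)$ let $e'(\pi')$ be the number of indices $i \in \{1,\ldots,d\}$ with $h_i \in B'$. Then \[ p_{\mathcal{A}}(n) = \sum_{\pi' \in \mathcal{H}(n)} 2^{e'(\pi')}.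 \]
   Context: A set $S$ of integers is sum-free modulo $m$ if its elements are pairwise incongruent modulo $m$ and the congruence $s_{i_1} + s_{i_2} \equiv s_j \pmod m$ has no solution with $s_{i_1}, s_{i_2}, s_j \in S$. It is a Sidon set modulo $m$ if its elements are pairwise incongruent modulo $m$ and $s_{i_1} + s_{i_2} \equiv s_{j_1} + s_{j_2} \pmod m$ holds if and only if $\{i_1,i_2\} = \{j_1,j_2\}$. Note that elements of $S$ are not required to lie in $\{1,\ldots,m\}$. *)

(* Defs.v *)
From HB Require Import structures.
From mathcomp Require Import all_boot finmap.
From mathcomp Require Import boolp classical_sets.

Set Implicit Arguments.
Unset Strict Implicit.
Unset Printing Implicit Defensive.

Local Open Scope nat_scope.

Definition incongruent (m : nat) (S : {fset nat}) : Prop :=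
  {in S &, forall s t, s = t %[mod m] -> s = t}.

Definition sum_free_mod (m : nat) (S : {fset nat}) : Prop :=
  incongruent m S /\
  forall s1 s2 s3, s1 \in S -> s2 \in S -> s3 \in S ->
    ~ (s1 + s2 = s3 %[mod m]).

Definition sidon_mod (m : nat) (S : {fset nat}) : Prop :=
  incongruent m S /\
  forall s1 s2 t1 t2, s1 \in S -> s2 \in S -> t1 \in S -> t2 \in S ->
    (s1 + s2 = t1 + t2 %[mod m]) <-> [fset s1; s2]%fset = [fset t1; t2]%fset.

Definition sumset2 (S : {fset nat}) : {fset nat} :=
  [fset (s + s')%N | s in S, s' in S]%fset.

Definition Aset (m : nat) (S : {fset nat}) : set nat :=
  [set a | exists u s, s \in S /\ a = u * m + s]%classic.

Definition Bset (m : nat) (S : {fset nat}) : set nat :=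
  [set h | exists v s s',
     [/\ 1 <= v, s \in S, s' \in S & h = v * m + s + s']]%classic.

Definition B'set (m : nat) (S : {fset nat}) : set nat :=
  [set h | exists v s s',
     [/\ 1 <= v, s \in S, s' \in S, s != s' & h = v * m + s + s']]%classic.

Definition Hset (m : nat) (S : {fset nat}) : set nat :=
  (Aset m S `|` Bset m S)%classic.

(* The u >= 0 with h = u m + t for some t in T, and 0 if there is none;
   [quoE] shows that it is well defined when T is incongruent modulo m. *)
Definition quo (m : nat) (T : {fset nat}) (h : nat) : nat :=
  xget 0 [set u | exists2 t, t \in T & h = u * m + t]%classic.

Definition u_of (m : nat) (S : {fset nat}) : nat -> nat := quo m S.

Definition v_of (m : nat) (S : {fset nat}) : nat -> nat :=
  quo m (S `|` sumset2 S)%fset.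

Lemma quoE m T u t : 0 < m -> incongruent m T -> t \in T ->
  quo m T (u * m + t) = u.
Proof.
move=> m0 iT tT; apply: xget_unique; first by exists t.
move=> v [t' t'T E].
have tt' : t = t' by apply: iT => //; rewrite -(modnMDl u) E modnMDl.
by move: E; rewrite tt' => /addIn /eqP; rewrite eqn_pmul2r // => /eqP.
Qed.

Lemma incongruent_sumset2 m S : sum_free_mod m S -> sidon_mod m S ->
  incongruent m (S `|` sumset2 S)%fset.
Proof.
move=> [iS sfS] [_ sS] x y; rewrite !in_fsetU.
case/orP=> [xS|/imfset2P[a aS [b bS ->]]];
  case/orP=> [yS|/imfset2P[c cS [d dS ->]]].
- exact: iS.
- by move/esym/(sfS _ _ _ cS dS xS).
- by move/(sfS _ _ _ aS bS yS).
- move/(sS _ _ _ _ aS bS cS dS) => E.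
  have: a \in [fset c; d]%fset by rewrite -E !inE eqxx.
  have: b \in [fset c; d]%fset by rewrite -E !inE eqxx orbT.
  have: c \in [fset a; b]%fset by rewrite E !inE eqxx.
  have: d \in [fset a; b]%fset by rewrite E !inE eqxx orbT.
  rewrite !inE => /orP[]/eqP hd /orP[]/eqP hc /orP[]/eqP hb /orP[]/eqP ha;
    by subst; rewrite // addnC.
Qed.

(* A partition of n is encoded as the weakly decreasing list of its parts. *)
Definition is_partition (n : nat) (p : seq nat) : bool :=
  [&& sorted geq p, 0 \notin p & sumn p == n].

Record partition_of (n : nat) := Partition {
  parts :> seq nat;
  partsP : is_partition n parts }.

HB.instance Definition _ n := [isSub for (@parts n)].
HB.instance Definition _ n := [Countable of partition_of n by <:].

Definition partition_code n (p : partition_of n) : n.-bseq 'I_n.+1 :=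
  insub_bseq n (map inord p).

Definition partition_decode n (b : n.-bseq 'I_n.+1) : option (partition_of n) :=
  insub (map val b).

Lemma partition_codeK n : pcancel (@partition_code n) (@partition_decode n).
Proof.
move=> p; case/and3P: (partsP p) => _ p0 /eqP pn.
have sz : size (map (@inord n) p) <= n.
  rewrite size_map -[X in _ <= X]pn.
  elim: (parts p) p0 => //= x s IH; rewrite inE negb_or => /andP[x0 /IH].
  by case: x x0 => // x _ /(leq_add (isT : 1 <= x.+1)).
have le x : x \in parts p -> x <= n.
  rewrite -[X in _ -> _ <= X]pn; elim: (parts p) => //= y s IH; rewrite inE => /orP[/eqP->|/IH].
    exact: leq_addr.
  by move/leq_trans; apply; apply: leq_addl.
have E : map val (partition_code p) = parts p.
  have -> : partition_code p = map inord p :> seq _.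
    exact: (insubdK [bseq] sz).
  rewrite -map_comp map_id_in // => x /le xn /=.
  by rewrite inordK.
by rewrite /partition_decode E valK.
Qed.

HB.instance Definition _ n := isFinite.Build (partition_of n)
  (pcan_enumP (@partition_codeK n)).

(* Since u (resp. v) is strictly decreasing along the listing a (resp. h)
   required below, a partition has at most one such listing.  It need not be
   the weakly decreasing one, as elements of S may exceed m. *)
Definition calA (m : nat) (S : {fset nat}) (n : nat) : {set partition_of n} :=
  finset (fun p : partition_of n => `[<
    exists a : seq nat,
      [/\ perm_eq a p,
          {in a, forall x, Aset m S x} &
          forall i, i.+1 < size a ->
            u_of m S (nth 0 a i.+1) < u_of m S (nth 0 a i)] >]).

Definition calH (m : nat) (S : {fset nat}) (n : nat) : {set partition_of n} :=
  finset (fun p : partition_of n => `[<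
    exists h : seq nat,
      [/\ perm_eq h p,
          {in h, forall x, Hset m S x},
          forall i, i.+1 < size h ->
            v_of m S (nth 0 h i.+1) + 3 <= v_of m S (nth 0 h i) &
          forall i, i.+1 < size h -> Bset m S (nth 0 h i.+1) ->
            v_of m S (nth 0 h i.+1) + 4 <= v_of m S (nth 0 h i)] >]).

Definition pA (m : nat) (S : {fset nat}) (n : nat) : nat := #|calA m S n|.

Definition e' (m : nat) (S : {fset nat}) (p : seq nat) : nat :=
  count (fun h => `[< B'set m S h >]) p.

(* Main.v *)
(** Replacing each part by its level (u or v) and by the one or two elements of S
    it involves turns both sides into a sum over words w in S, whose terms depend
    only on k = |w| and on the sum N of the levels.  It remains to compare, for
    fixed k and N, the strictly decreasing sequences of k levels with the sequences
    of levels marked 1 or 2 (k being the sum of the marks) with the gaps of H.  If a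
    level 0 marked 2 is allowed, the latter have generating function
      W(x, y) = sum_(f, e) x^f y^e q^(3 C(f+e, 2) + C(e, 2)) / ((q)_e (q)_f),
    with W(x, y) = W(xq, y) + x W(xq^3, yq^3) = W(x, yq) + y W(xq^3, yq^4).
    Hence G(x) = W(xq, x^2 q) + x W(xq^3, x^2 q^3), which counts the sequences in
    question, satisfies G(x) = (1 + x) G(xq), the equation of prod_i (1 + x q^i). *)
Require Import Defs.
From mathcomp Require Import all_boot finmap.
From mathcomp Require Import all_algebra zify boolp.

Set Implicit Arguments.
Unset Strict Implicit.
Unset Printing Implicit Defensive.

Import GRing.Theory Num.Theory.

Local Open Scope nat_scope.

(** * Cardinality of predicates on infinite types *)

(** The predicates to be counted live on lists, an infinite type, so a duplicate-free enumeration
    carries both finiteness and cardinality. *)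
Definition has_card (T : eqType) (P : T -> Prop) (n : nat) : Prop :=
  exists2 l : seq T, uniq l & (forall x, x \in l <-> P x) /\ size l = n.

Section HasCard.
Variables T U : eqType.
Implicit Types (P Q : T -> Prop) (n : nat).

Lemma has_card_fun P n n' : has_card P n -> has_card P n' -> n = n'.
Proof.
move=> [l ul [lP <-]] [l' ul' [l'P <-]]; apply/perm_size/uniq_perm => // x.
by apply/idP/idP => [/lP/l'P|/l'P/lP].
Qed.

Lemma eq_has_card P Q n : (forall x, P x <-> Q x) -> has_card P n -> has_card Q n.
Proof. by move=> PQ [l ul [lP sl]]; exists l => //; split=> // x; rewrite lP PQ. Qed.

Lemma has_card0 P : (forall x, ~ P x) -> has_card P 0.
Proof. by move=> nP; exists [::] => //; split=> // x; split=> // /nP. Qed.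

Lemma has_card1 P x : (forall y, P y <-> y = x) -> has_card P 1.
Proof.
move=> Px; exists [:: x] => //; split=> // y; rewrite inE Px.
by split=> [/eqP|->].
Qed.

Lemma has_card_union P Q n n' :
    (forall x, P x -> Q x -> False) -> has_card P n -> has_card Q n' ->
  has_card (fun x => P x \/ Q x) (n + n').
Proof.
move=> PQ [l ul [lP <-]] [l' ul' [l'P <-]]; exists (l ++ l').
  rewrite cat_uniq ul ul' andbT; apply/hasPn => x /l'P Qx.
  by apply/negP => /lP /PQ; apply.
split=> [x|]; last exact: size_cat.
by rewrite mem_cat -lP -l'P; split=> /orP.
Qed.

Lemma has_card_image_in (Q : U -> Prop) P n (g : T -> U) :
    (forall x x', P x -> P x' -> g x = g x' -> x = x') ->
    (forall y, Q y <-> exists2 x, P x & y = g x) ->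
  has_card P n -> has_card Q n.
Proof.
move=> gI Qg [l ul [lP <-]]; exists (map g l).
  by rewrite map_inj_in_uniq // => x x' /lP Px /lP; apply: gI.
split=> [y|]; last exact: size_map.
rewrite Qg; split=> [/mapP[x /lP Px ->]|[x /lP xl ->]]; first by exists x.
exact: map_f.
Qed.

Lemma has_card_image (Q : U -> Prop) P n (g : T -> U) :
    injective g -> (forall y, Q y <-> exists2 x, P x & y = g x) ->
  has_card P n -> has_card Q n.
Proof. by move=> gI; apply: has_card_image_in => x x' _ _ /gI. Qed.

End HasCard.

Lemma has_card_sum (T I : eqType) (r : seq I) (P : I -> T -> Prop) (n : I -> nat) :
    uniq r -> (forall i j x, P i x -> P j x -> i = j) ->
    (forall i, i \in r -> has_card (P i) (n i)) ->
  has_card (fun x => exists2 i, i \in r & P i x) (\sum_(i <- r) n i).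
Proof.
move=> + PI; elim: r => [|i r IH] /=; first by rewrite big_nil => *; apply: has_card0 => x [].
case/andP=> ir ur cP; rewrite big_cons.
have cr : has_card (fun x => exists2 j, j \in r & P j x) (\sum_(j <- r) n j).
  by apply: IH => // j jr; apply: cP; rewrite inE jr orbT.
apply: eq_has_card (has_card_union _ (cP i (mem_head _ _)) cr) => x.
  split=> [[Px|[j jr Px]]|[j]]; first by exists i => //; apply: mem_head.
    by exists j => //; rewrite inE jr orbT.
  by rewrite inE => /orP[/eqP->|jr] Px; [left|right; exists j].
by move=> Pi [j jr Pj]; move: ir; rewrite (PI _ _ _ Pi Pj) jr.
Qed.

Lemma has_card_cons (T : eqType) (P : T -> Prop) (Q : seq T -> Prop) n n' :
    has_card P n -> has_card Q n' ->
  has_card (fun s => if s is x :: s' then P x /\ Q s' else False) (n * n').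
Proof.
move=> [l ul [lP <-]] [l' ul' [l'P <-]].
exists [seq x :: s | x <- l, s <- l'].
  by apply: allpairs_uniq => // -[x s] [y t] _ _ /= [-> ->].
split=> [s|]; last by rewrite size_allpairs.
split=> [/allpairsP[[x s'] /= [/lP ? /l'P ? ->]]//|].
by case: s => // x s [/lP ? /l'P ?]; apply: allpairs_f.
Qed.

(** * The q-series identity *)

(* Truncated Cauchy product with 1/(1 - q^j), exact for series F supported in
   nonnegative degrees. *)
Definition geo (j : nat) (F : int -> nat) (M : int) : nat :=
  \sum_(i < `|M|.+1) F (M - (i * j)%:Z)%R.

Lemma geo_neg j F M : (forall M, (M < 0)%R -> F M = 0) -> (M < 0)%R -> geo j F M = 0.
Proof. by move=> F0 M0; apply: big1 => i _; apply: F0; lia. Qed.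

Lemma geo_rec j F M : 0 < j -> (forall M, (M < 0)%R -> F M = 0) ->
  geo j F M = F M + geo j F (M - j%:Z)%R.
Proof.
move=> j0 F0.
(* Terms beyond [|M'|] have negative degree, so the range may be lengthened. Giving the sum at M one
   term more than the sum at M - j lets F M be split off. *)
have gE K M' : `|M'| <= K -> geo j F M' = \sum_(i < K.+1) F (M' - (i * j)%:Z)%R.
  move=> MK; rewrite /geo -!(big_mkord xpredT (fun i => F (M' - (i * j)%:Z)%R)).
  rewrite [RHS](@big_cat_nat _ _ _ `|M'|.+1) //=.
  rewrite [X in _ = _ + X]big1_seq ?addn0 // => i /andP[_]; rewrite mem_index_iota => /andP[iM _].
  by apply: F0; have : i <= i * j by [rewrite leq_pmulr]; lia.
rewrite (gE (`|M| + j).+1); last by lia.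
rewrite (gE (`|M| + j) (M - _)%R); last by lia.
rewrite big_ord_recl /= mul0n; congr (F _ + _); first by lia.
by apply: eq_bigr => i _; congr F; rewrite /bump /= ; lia.
Qed.

(* Coefficient of q^M in 1/((q;q)_e (q;q)_f). *)
Fixpoint qpoch_inv (f : nat) : int -> nat :=
  if f is f'.+1 then geo f (qpoch_inv f') else fun M => (M == 0%R).

Fixpoint qpoch_inv2 (e f : nat) : int -> nat :=
  if e is e'.+1 then geo e (qpoch_inv2 e' f) else qpoch_inv f.

Lemma qpoch_inv_neg f M : (M < 0)%R -> qpoch_inv f M = 0.
Proof.
elim: f M => [|f IH] M M0 /=; last exact: geo_neg.
by case: eqP => // ME; move: M0; rewrite ME.
Qed.

Lemma qpoch_inv2_neg e f M : (M < 0)%R -> qpoch_inv2 e f M = 0.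
Proof. by elim: e M => [|e IH] M M0 /=; [exact: qpoch_inv_neg|exact: geo_neg]. Qed.

Lemma qpoch_inv2_recl e f M :
  qpoch_inv2 e.+1 f M = qpoch_inv2 e f M + qpoch_inv2 e.+1 f (M - e.+1%:Z)%R.
Proof. by rewrite /= geo_rec // => *; apply: qpoch_inv2_neg. Qed.

(** Induction for series that vanish in negative degrees and whose degree M is reached from degree M
    - j. *)
Lemma int_ind_down (P : int -> Prop) (j : nat) : 0 < j ->
  (forall M : int, (M < 0)%R -> P M) -> (forall M : int, P (M - j%:Z)%R -> P M) ->
  forall M : int, P M.
Proof.
move=> j0 P0 PS M; have [k] := ubnP `|M|.
elim: k M => // k IH M Mk; case: (ltrP M 0%R) => [/P0//|M0]; apply: PS.
by case: (ltrP (M - j%:Z)%R 0%R) => [/P0//|?]; apply: IH; lia.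
Qed.

(** The factor 1/(1 - q^(f+1)) lies under the e factors of the outer recursion. Induction on e, then
    on M, commutes its recurrence with theirs. *)
Lemma qpoch_inv2_recr e f M :
  qpoch_inv2 e f.+1 M = qpoch_inv2 e f M + qpoch_inv2 e f.+1 (M - f.+1%:Z)%R.
Proof.
elim: e M => [|e IH] M.
  by rewrite /= geo_rec // => *; apply: qpoch_inv_neg.
move: M; apply: (int_ind_down (ltn0Sn e)) => [M M0|M IHM].
  by rewrite !qpoch_inv2_neg //; lia.
rewrite !(qpoch_inv2_recl e _ M) (qpoch_inv2_recl e _ (M - f.+1%:Z)%R) IH IHM.
have -> : (M - f.+1%:Z - e.+1%:Z = M - e.+1%:Z - f.+1%:Z)%R by lia.
exact: addnACA.
Qed.

(** Coefficient of x^f y^e q^M in W. Integer indices, with value 0 at negative ones, spare the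
    recurrences their boundary cases. *)
Definition wt (f e M : int) : nat :=
  match f, e with
  | Posz f, Posz e =>
      qpoch_inv2 e f (M - (3 * 'C(f + e, 2) + 'C(e, 2))%:Z)%R
  | _, _ => 0
  end.

Lemma wt_negf f e M : (f < 0)%R -> wt f e M = 0. Proof. by case: f. Qed.
Lemma wt_nege f e M : (e < 0)%R -> wt f e M = 0. Proof. by case: f e => [f|//] []. Qed.

Lemma wtE (f e : nat) M :
  wt f e M = qpoch_inv2 e f (M - (3 * 'C(f + e, 2) + 'C(e, 2))%:Z)%R.
Proof. by []. Qed.

(** Since 1/(q)_f = q^f/(q)_f + 1/(q)_(f-1), and C(f+e, 2) exceeds C(f+e-1, 2) by f+e-1. In series
    form: W(x, y) = W(xq, y) + x W(xq^3, yq^3). *)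
Lemma wt_recf f e M :
  wt f e M = wt f e (M - f)%R + wt (f - 1)%R e (M - 3 * (f + e - 1))%R.
Proof.
case: e => e; last by rewrite !wt_nege.
case: f => [[|f]|f]; last by rewrite !wt_negf.
  by rewrite [X in _ + X]wt_negf // addn0 subr0.
have -> : (f.+1%:Z - 1 = f%:Z)%R by lia.
rewrite !wtE qpoch_inv2_recr addnC; congr (_ + _); congr qpoch_inv2; first by lia.
by rewrite addSn binS bin1; lia.
Qed.

(** The same splitting of 1/(q)_e; the second binomial now contributes e-1 more. In series form:
    W(x, y) = W(x, yq) + y W(xq^3, yq^4). *)
Lemma wt_rece f e M :
  wt f e M = wt f e (M - e)%R + wt f (e - 1)%R (M - 3 * (f + e - 1) - (e - 1))%R.
Proof.
case: f => f; last by rewrite !wt_negf.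
case: e => [[|e]|e]; last by rewrite !wt_nege.
  by rewrite [X in _ + X]wt_nege // addn0 subr0.
have -> : (e.+1%:Z - 1 = e%:Z)%R by lia.
rewrite !wtE qpoch_inv2_recl addnC; congr (_ + _); congr qpoch_inv2; first by lia.
by rewrite addnS !binS !bin1; lia.
Qed.

Lemma wt_negM f e M : (M < 0)%R -> wt f e M = 0.
Proof. by case: f e => [f|//] [e|//] /= M0; apply: qpoch_inv2_neg; lia. Qed.

(* Coefficient of x^k q^N in W(x q^a, x^2 q^b), W(x, y) = sum of wt f e M x^f y^e q^M. *)
Definition wsum (a b : nat) (k N : int) : nat :=
  \sum_(e < `|k|.+1) wt (k - 2 * e%:Z)%R e (N - a%:Z * (k - 2 * e%:Z) - b%:Z * e%:Z)%R.

(** For e > |k| the index k - 2e is negative. A common bound lets sums for k, k-1 and k-2 be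
    compared term by term. *)
Lemma wsumE K a b k N : `|k| <= K -> wsum a b k N =
  \sum_(e < K.+1) wt (k - 2 * e%:Z)%R e (N - a%:Z * (k - 2 * e%:Z) - b%:Z * e%:Z)%R.
Proof.
move=> kK; rewrite /wsum.
rewrite -!(big_mkord xpredT (fun e =>
  wt (k - 2 * e%:Z)%R e (N - a%:Z * (k - 2 * e%:Z) - b%:Z * e%:Z)%R)).
rewrite [RHS](@big_cat_nat _ _ _ `|k|.+1) //=.
rewrite [X in _ = _ + X]big1_seq ?addn0 // => e /andP[_]; rewrite mem_index_iota => /andP[ke _].
by apply: wt_negf; lia.
Qed.

Lemma wsum_reca a b k N :
  wsum a b k N = wsum a.+1 b k N + wsum a.+3 b.+3 (k - 1)%R (N - a%:Z)%R.
Proof.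
rewrite !(@wsumE (`|k|.+1)); try lia.
rewrite -big_split /=; apply: eq_bigr => e _.
rewrite wt_recf; congr (_ + _); last have -> : (k - 2 * e%:Z - 1 = k - 1 - 2 * e%:Z)%R by lia.
  by congr wt; lia.
by congr wt; lia.
Qed.

Lemma wsum_recb a b k N :
  wsum a b k N = wsum a b.+1 k N + wsum a.+3 b.+4 (k - 2)%R (N - b%:Z)%R.
Proof.
rewrite !(@wsumE (`|k| + 2)); try lia.
under eq_bigr do rewrite wt_rece.
rewrite big_split /=; congr (_ + _).
  by apply: eq_bigr => e _; congr wt; lia.
(* The second sum is reindexed by e - 1: on the left its term e = 0 has index -1, and on the right
   the last term has k - 2 - 2e < 0. *)
rewrite big_ord_recl big_ord_recr /= wt_nege // add0n wt_negf ?addn0; last by lia.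
by apply: eq_bigr => e _; congr wt; rewrite /bump /=; lia.
Qed.

(* Replacing x by x q multiplies the coefficient of x^k by q^k. *)
Lemma wsum_shift a b k N : wsum a.+1 b.+2 k N = wsum a b k (N - k)%R.
Proof. by apply: eq_bigr => e _; congr wt; lia. Qed.

(** Coefficient of x^k q^N in G. The first summand is the case of positive levels only, the second
    that of a lowest level 0 marked 1. *)
Definition gcoef (k N : int) : nat := wsum 1 1 k N + wsum 3 3 (k - 1)%R N.

(** This is G(x) = (1 + x) G(xq). Write w(a, b) = W(xq^a, x^2 q^b). By [e1], [e2], [e3], [e5],
    w(1,1) equals w(2,3) + x^2 q^2 w(5,6) + x^2 q w(5,5) + xq w(4,5) + x^3 q^5 w(7,8). By [e4], x
    w(3,3) and the w(5,6) term make x w(2,3); by [e6], the w(5,5) and w(7,8) terms make x^2 q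
    w(4,5). The total is (1 + x)(w(2,3) + xq w(4,5)), and [s1] to [s4] recognize G(xq). *)
Lemma gcoef_rec k N : gcoef k N = gcoef k (N - k)%R + gcoef (k - 1)%R (N - (k - 1))%R.
Proof.
rewrite /gcoef.
have E1 : (k - 1 - 1 = k - 2)%R by lia.
have E2 : (k - 1 - 2 = k - 2 - 1)%R by lia.
have E3 : (N - 1 - (k - 1) = N - k)%R by lia.
have E4 : (N - 1 - (k - 2) = N - (k - 1))%R by lia.
have E5 : (N - 1 - 4 = N - 5)%R by lia.
have e1 : wsum 1 1 k N = wsum 2 1 k N + wsum 4 4 (k - 1)%R (N - 1)%R := wsum_reca 1 1 k N.
have e2 : wsum 2 1 k N = wsum 2 2 k N + wsum 5 5 (k - 2)%R (N - 1)%R := wsum_recb 2 1 k N.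
have e3 : wsum 2 2 k N = wsum 2 3 k N + wsum 5 6 (k - 2)%R (N - 2)%R := wsum_recb 2 2 k N.
have e4 : wsum 2 3 (k - 1)%R N = wsum 3 3 (k - 1)%R N + wsum 5 6 (k - 2)%R (N - 2)%R.
  by rewrite (wsum_reca 2 3) E1.
have e5 : wsum 4 4 (k - 1)%R (N - 1)%R
    = wsum 4 5 (k - 1)%R (N - 1)%R + wsum 7 8 (k - 2 - 1)%R (N - 5)%R.
  by rewrite (wsum_recb 4 4) E2 E5.
have e6 : wsum 4 5 (k - 2)%R (N - 1)%R
    = wsum 5 5 (k - 2)%R (N - 1)%R + wsum 7 8 (k - 2 - 1)%R (N - 5)%R.
  by rewrite (wsum_reca 4 5) E5.
have s1 : wsum 2 3 k N = wsum 1 1 k (N - k)%R := wsum_shift 1 1 k N.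
have s2 : wsum 4 5 (k - 1)%R (N - 1)%R = wsum 3 3 (k - 1)%R (N - k)%R.
  by rewrite (wsum_shift 3 3) E3.
have s3 : wsum 2 3 (k - 1)%R N = wsum 1 1 (k - 1)%R (N - (k - 1))%R := wsum_shift 1 1 _ N.
have s4 : wsum 4 5 (k - 2)%R (N - 1)%R = wsum 3 3 (k - 2)%R (N - (k - 1))%R.
  by rewrite (wsum_shift 3 3) E4.
rewrite E1; lia.
Qed.

Lemma gcoef_negN k N : (0 <= k)%R -> (N < 0)%R -> gcoef k N = 0.
Proof.
move=> k0 N0; rewrite /gcoef /wsum !big1 // => e _;
  set f := (_ - 2 * _)%R; case: (ltrP f 0%R) => f0; try exact: wt_negf;
  apply: wt_negM; nia.
Qed.

Lemma gcoef0 N : gcoef 0 N = (N == 0%R).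
Proof.
rewrite /gcoef (_ : wsum 3 3 _ N = 0); last by apply: big1 => e _; apply: wt_negf; lia.
rewrite /wsum big_ord_recl big_ord0 !addn0 /=.
by rewrite !bin_small //; congr (nat_of_bool (_ == _)); lia.
Qed.

(** * Skeletons of partitions *)

(* A skeleton lists, from the lowest level up, the pairs (level, number of
   summands from S) of the parts of a partition. *)
Notation skeleton := (seq (nat * nat)).

Definition levels (c : skeleton) : nat := sumn (unzip1 c).

Definition letters (c : skeleton) : nat := sumn (unzip2 c).

(** The required distance depends only on the mark of the lower neighbour [y], as it does in H. *)
Definition gap (g : nat -> nat) (y x : nat * nat) : bool := y.1 + g y.2 <= x.1.

Definition skel (T : pred nat) (g : nat -> nat) (c : skeleton) : bool :=
  all (fun x => T x.2) c && sorted (gap g) c.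

Definition shift (j : nat) : skeleton -> skeleton := map (fun x => (x.1 + j, x.2)).

Lemma shift_inj j : injective (shift j).
Proof. by apply: inj_map => -[a b] [a' b'] /= [/addIn -> ->]. Qed.

Lemma levels_cons x c : levels (x :: c) = x.1 + levels c. Proof. by []. Qed.

Lemma letters_cons x c : letters (x :: c) = x.2 + letters c. Proof. by []. Qed.

Lemma levels_shift j c : levels (shift j c) = levels c + j * size c.
Proof.
by elim: c => [|x c IH] /=; [rewrite muln0|rewrite !levels_cons IH /=; lia].
Qed.

Lemma letters_shift j c : letters (shift j c) = letters c.
Proof. by rewrite /letters /unzip2 -map_comp. Qed.

Lemma unshift j c : all (fun x => j <= x.1) c -> exists c', c = shift j c'.
Proof.
elim: c => [|[a b] c IH] /=; first by exists [::].
by case/andP=> ja /IH[c' ->]; exists ((a - j, b) :: c') => /=; rewrite subnK.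
Qed.

Lemma gap_trans g : transitive (gap g).
Proof. by rewrite /gap => y x z; lia. Qed.

Lemma skel_cons T g x c :
  skel T g (x :: c) = [&& T x.2, all (gap g x) c & skel T g c].
Proof.
by rewrite /skel /= (path_sortedE (@gap_trans g)); case: (T _); case: (all _ c) => //=; rewrite andbF.
Qed.

Lemma skel_shift T g j c : skel T g (shift j c) = skel T g c.
Proof.
elim: c => // x c IH; rewrite [shift _ _]/= !skel_cons IH /= all_map; congr [&& _, _ & _].
by apply: eq_all => y; rewrite /gap /=; lia.
Qed.

(** Everything above a level 0 marked t starts at level [g t] or higher, and lowering it by [g t]
    removes the constraint. With [skel_pos], for a positive lowest level, this gives all recurrences
    for skeletons. *)
Lemma skel0_cons T g t c : skel T g ((0, t) :: c) <->
  T t /\ exists2 c', skel T g c' & c = shift (g t) c'.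
Proof.
rewrite skel_cons; split=> [/and3P[/= Tt cg cT]|[/= -> [c' c'T ->]]].
  split=> //; have [c' cE] := unshift cg; exists c' => //.
  by rewrite cE skel_shift in cT.
rewrite skel_shift c'T andbT /= all_map; apply/allP => y _.
by rewrite /gap /=; lia.
Qed.

Lemma skel_pos T g x c : skel T g (x :: c) -> 0 < x.1 ->
  exists2 c', skel T g c' & x :: c = shift 1 c'.
Proof.
move=> xc x0; have [|c' cE] := @unshift 1 (x :: c).
  move: xc; rewrite skel_cons /= x0 => /and3P[_ xc _].
  by apply: sub_all xc => y; rewrite /gap; lia.
by exists c' => //; rewrite cE skel_shift in xc.
Qed.

(** * Enumeration of the skeletons of both sides *)

Definition single : pred nat := pred1 1.
Definition single_or_pair : pred nat := [pred t | (t == 1) || (t == 2)].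
Definition gapA (t : nat) : nat := 1.
(** Distance 3 above a part of A and 4 above a part of B. *)
Definition gapH (t : nat) : nat := t.+2.

Definition skelA : pred skeleton := skel single gapA.
(** The second condition reflects v >= 1 in B: a level 0 is never marked 2. *)
Definition skelH (c : skeleton) : bool :=
  skel single_or_pair gapH c && all (fun x => (x.2 == 2) ==> (0 < x.1)) c.

Lemma single_sum2 (c : skeleton) : all (fun x => single x.2) c -> letters c = size c.
Proof. by elim: c => // x c IH /andP[/eqP /= t1 /IH]; rewrite letters_cons t1 => ->. Qed.

(** If the lowest level is positive, all d+1 levels drop by 1; if it is 0, it is removed and the
    other d levels drop by 1. These are the two terms of [gcoef_rec]. *)
Lemma has_card_skelA_size (d : nat) (N : int) :
  has_card (fun c : skeleton => [/\ skelA c, size c = d & (levels c)%:Z%R = N])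
    (gcoef d N).
Proof.
elim: d N => [|d IH] N.
  rewrite gcoef0; case: eqP => N0 /=.
    by apply: (@has_card1 _ _ [::]) => -[|x c]; split=> // -[].
  by apply: has_card0 => -[|x c] [] // _ _ /esym.
move: N; apply: (int_ind_down (ltn0Sn d)) => [N N0|N IHN].
  by rewrite gcoef_negN //; apply: has_card0 => c [_ _]; lia.
have := has_card_union _ (has_card_image (@shift_inj 1) (fun=> iff_refl _) IHN)
  (has_card_image (g := fun c : skeleton => (0, 1) :: shift 1 c) _ (fun=> iff_refl _)
    (IH (N - d%:Z)%R)).
have -> : gcoef d.+1 (N - d.+1%:Z)%R + gcoef d (N - d%:Z)%R = gcoef d.+1 N.
  rewrite [RHS]gcoef_rec; congr (_ + gcoef _ _); lia.
move=> H; apply: eq_has_card (H _ _) => {H} [c|c|c c' [] /shift_inj //]; last first.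
  by case=> -[|x c'] _ -> [c'' _] //= []; rewrite addn1.
split=> [[[c' [c's cd cN] ->]|[c' [c's cd cN] ->]]|[cs cd cN]].
- split; [by rewrite /skelA skel_shift|by rewrite size_map|].
  by rewrite levels_shift cd; move: cN; lia.
- split; [|by rewrite /= size_map cd|by rewrite levels_cons /= levels_shift cd; move: cN; lia].
  by apply/skel0_cons; split=> //; exists c'.
case: c cs cd cN => // -[[|a] t] c cs [cd] cN.
  right; have [/eqP /= tE [c' c's cE]] := (skel0_cons single gapA t c).1 cs.
  exists c'; last by rewrite cE tE.
  rewrite cE in cd cN; rewrite size_map in cd.
  by split=> //; move: cN; rewrite levels_cons /= levels_shift /gapA; lia.
left; have [//|c' c's cE] := skel_pos cs; exists c' => //; split=> //.
  by move/(congr1 size): cE; rewrite size_map /= cd.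
by move: cN; rewrite cE levels_shift; move/(congr1 size): cE; rewrite size_map /= cd; lia.
Qed.

Lemma has_card_skelA (k N : nat) :
  has_card (fun c : skeleton => [/\ skelA c, letters c = k & levels c = N])
    (gcoef k N).
Proof.
apply: eq_has_card (has_card_skelA_size k N) => c.
split=> -[cA ck cN]; move: ck; rewrite single_sum2 //; try by case/andP: cA.
  by split=> //; lia.
by split=> //; lia.
Qed.

(** A level 0 marked 2 is allowed here. With d marks equal to 1 or 2 and total d + e, exactly e of
    them are 2. *)
Definition free_skel (d : nat) (e N : int) (c : skeleton) : Prop :=
  [/\ skel single_or_pair gapH c, size c = d,
      (letters c)%:Z%R = (d%:Z + e)%R & (levels c)%:Z%R = N].

Lemma free_skel_shift d e N j c :
  free_skel d e N (shift j c) <-> free_skel d e (N - (j * d)%:Z)%R c.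
Proof.
rewrite /free_skel skel_shift letters_shift levels_shift size_map.
by split=> -[cs cd ct cN]; split=> //; move: cN; rewrite cd; lia.
Qed.

Lemma free_skel_cons0 d e N t c : t \in [:: 1; 2] ->
  free_skel d.+1 e N ((0, t) :: shift t.+2 c) <->
  free_skel d (e + 1 - t%:Z)%R (N - (t.+2 * d)%:Z)%R c.
Proof.
move=> t12; rewrite /free_skel letters_cons levels_cons letters_shift levels_shift /= size_map add0n.
split=> -[cs cd ct cN].
  have [_ [c' c's /shift_inj cE]] := (skel0_cons single_or_pair gapH t _).1 cs.
  by rewrite cE; split=> //; rewrite -?cE; move: cN ct; case: cd => ->; lia.
split; [|by rewrite cd|by move: ct; lia|by move: cN; rewrite cd; lia].
apply/skel0_cons; split; last by exists c.
by move: t12; rewrite !inE.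
Qed.

(** The lowest part has positive level, or level 0 with mark 1, or level 0 with mark 2. *)
Lemma free_skelS d e N c : free_skel d.+1 e N c <->
  (exists2 c', free_skel d.+1 e (N - d.+1%:Z)%R c' & c = shift 1 c') \/
  ((exists2 c', free_skel d e (N - (3 * d)%:Z)%R c' & c = (0, 1) :: shift 3 c') \/
   (exists2 c', free_skel d (e - 1)%R (N - (4 * d)%:Z)%R c' & c = (0, 2) :: shift 4 c')).
Proof.
split=> [cF|[[c' c'F ->]|[[c' c'F ->]|[c' c'F ->]]]]; last 3 first.
- by apply/free_skel_shift; rewrite mul1n.
- by apply/free_skel_cons0 => //; rewrite addrK.
- by apply/free_skel_cons0 => //; rewrite (_ : e + 1 - 2%:Z = e - 1)%R //; lia.
have [cs cd _ _] := cF; case: c cs cd cF => // -[[|a] t] c cs _ cF; last first.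
  left; have [//|c' c's cE] := skel_pos cs; exists c' => //.
  by move: cF; rewrite cE => /free_skel_shift; rewrite mul1n.
right; have [/orP[]/eqP /= tE [c' c's cE]] := (skel0_cons single_or_pair gapH t c).1 cs.
  left; exists c'; last by rewrite cE tE.
  by move: cF; rewrite cE tE => /free_skel_cons0 -/(_ isT); rewrite addrK.
right; exists c'; last by rewrite cE tE.
move: cF; rewrite cE tE => /free_skel_cons0 -/(_ isT).
by rewrite (_ : e + 1 - 2%:Z = e - 1)%R //; lia.
Qed.

Lemma cons_shift_inj p j : injective (fun c : skeleton => p :: shift j c).
Proof. by move=> c c' [/shift_inj]. Qed.

(** The combinatorial meaning of W: f = d - e counts the marks 1 and e the marks 2. *)
Lemma has_card_free_skel d e N : has_card (free_skel d e N) (wt (d%:Z - e)%R e N).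
Proof.
elim: d e N => [|d IH] e N.
  have [->|e0] := eqVneq e 0%R.
    rewrite wtE /= !bin_small // subr0; case: eqP => N0 /=.
      apply: (@has_card1 _ _ [::]) => -[|x c]; split=> // -[] //.
    by apply: has_card0 => -[|x c] [] // _ _ _ /esym.
  rewrite (_ : wt _ _ _ = 0); last by case: e e0 => [[|e]|e].
  apply: has_card0 => -[|x c] [] // _ _; rewrite /letters /=; lia.
move: N; apply: (int_ind_down (ltn0Sn d)) => [N N0|N IHN].
  by rewrite wt_negM //; apply: has_card0 => c [_ _ _]; lia.
(* As f + e = d + 1, the three resulting terms lower N by d + 1, 3d and 4d: the three cases of
   [free_skelS]. *)
rewrite wt_recf [X in X + _]wt_rece -addnA [X in _ + X]addnC.
have h1 := has_card_image (@shift_inj 1) (fun=> iff_refl _) IHN.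
have h2 := has_card_image (@cons_shift_inj (0, 1) 3) (fun=> iff_refl _)
    (IH e (N - (3 * d)%:Z)%R).
have h3 := has_card_image (@cons_shift_inj (0, 2) 4) (fun=> iff_refl _)
    (IH (e - 1)%R (N - (4 * d)%:Z)%R).
have h23 : has_card _ _ := has_card_union _ h2 h3.
have h123 : has_card _ _ := has_card_union _ h1 (h23 _).
rewrite (_ : _ + _ = wt (d.+1%:Z - e)%R e (N - d.+1%:Z)%R +
   (wt (d%:Z - e)%R e (N - (3 * d)%:Z)%R + wt (d%:Z - (e - 1))%R (e - 1)%R (N - (4 * d)%:Z)%R)).
  apply: eq_has_card (h123 _ _) => {h1 h2 h3 h23 h123}.
  - by move=> c; split=> [?|/free_skelS//]; apply/free_skelS.
  - move=> c [[|x c1] c1F ->]; first by case: c1F.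
    by case=> -[c2 _] /= []; rewrite addn1.
  - by move=> c [c1 _ ->] [c2 _].
congr (_ + (_ + _)); congr wt; lia.
Qed.

(** Of the three cases of [free_skelS], a level 0 marked 2 is excluded; the other two give the two
    terms. An integer d allows d = k - e for e up to k + 1. *)
Lemma has_card_skelH_size (d e N : int) :
  has_card (fun c : skeleton => [/\ skelH c, (size c)%:Z%R = d,
      (letters c)%:Z%R = (d + e)%R & (levels c)%:Z%R = N])
    (wt (d - e)%R e (N - d)%R + wt (d - 1 - e)%R e (N - 3 * (d - 1))%R).
Proof.
case: d => [[|d]|d]; last 1 first.
- rewrite (_ : _ + _ = 0); first by apply: has_card0 => c [_]; lia.
  by case: (ltrP e 0%R) => e0; [rewrite !wt_nege|rewrite !wt_negf //; lia].
- rewrite [X in _ + X](_ : _ = 0) ?addn0 ?subr0; last first.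
    by case: (ltrP e 0%R) => e0; [rewrite wt_nege|rewrite wt_negf //; lia].
  apply: eq_has_card (has_card_free_skel 0 e N) => c.
  by case: c => [|x c]; split=> -[] //; split.
have h1 := has_card_image (@shift_inj 1) (fun=> iff_refl _)
    (has_card_free_skel d.+1 e (N - d.+1%:Z)%R).
have h2 := has_card_image (@cons_shift_inj (0, 1) 3) (fun=> iff_refl _)
    (has_card_free_skel d e (N - (3 * d)%:Z)%R).
have H := has_card_union _ h1 h2.
rewrite (_ : _ + _ = wt (d.+1%:Z - e)%R e (N - d.+1%:Z)%R +
   wt (d%:Z - e)%R e (N - (3 * d)%:Z)%R); last first.
  congr (_ + _); congr wt; lia.
apply: eq_has_card (H _) => [c|c]; last first.
  by case=> -[|x c1] c1F ->; [case: c1F|case=> c2 _ /= []; rewrite addn1].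
split.
  move=> cE; have : free_skel d.+1 e N c by apply/free_skelS; case: cE; [left|right; left].
  case=> cs cd ct cN; split; rewrite ?cd //; rewrite /skelH cs /=.
  by case: cE => -[c' _ ->]; rewrite /= all_map; apply/allP => x _ /=; lia.
case=> /andP[cs cpos] cd ct cN.
have /free_skelS : free_skel d.+1 e N c by split=> //; lia.
by case=> [?|[?|[c' _ cE]]]; [left|right|move: cpos; rewrite cE].
Qed.

(** Skeletons are sorted by the number e of marks 2; there are then k - e parts, k - 2e of them
    marked 1. *)
Lemma has_card_skelH (k N : nat) :
  has_card (fun c : skeleton => [/\ skelH c, letters c = k & levels c = N])
    (gcoef k N).
Proof.
have size_le c : skelH c -> size c <= letters c.
  case/andP=> /andP[+ _] _; elim: c => // x c IH /andP[+ /IH]; rewrite letters_cons /=.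
  by rewrite /single_or_pair /=; lia.
have H := has_card_sum (iota_uniq 0 k.+2) _
    (fun e _ => has_card_skelH_size (k%:Z - e%:Z)%R e%:Z%R N).
(* The bound k + 1 also covers |k - 1| when k = 0. *)
rewrite /gcoef !(@wsumE k.+1); try lia.
rewrite -big_split /= -(big_mkord xpredT (fun e =>
  wt (k%:Z - 2 * e%:Z)%R e (N%:Z - 1 * (k%:Z - 2 * e%:Z) - 1 * e%:Z)%R +
  wt (k%:Z - 1 - 2 * e%:Z)%R e (N%:Z - 3%:Z * (k%:Z - 1 - 2 * e%:Z) - 3%:Z * e%:Z)%R)).
rewrite (eq_bigr (fun e : nat => wt (k%:Z - e%:Z - e%:Z)%R e (N%:Z - (k%:Z - e%:Z))%R +
   wt (k%:Z - e%:Z - 1 - e%:Z)%R e (N%:Z - 3 * (k%:Z - e%:Z - 1))%R)); last first.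
  by move=> e _; congr (_ + _); congr wt; lia.
rewrite /index_iota subn0; apply: eq_has_card (H _) => [c|e e' c]; last first.
  by case=> _ -> _ _ [_ + _ _]; lia.
split=> [[e _ [cs cd ct cN]]|[cs ck cN]]; first by split=> //; lia.
have := size_le _ cs; rewrite ck => ck'.
exists (k - size c); first by rewrite mem_iota ltnS (leq_trans (leq_subr _ _)).
by rewrite -subzn //; split; rewrite ?ck ?cN // ?subKr // addrC subrK.
Qed.

(** * Decorated listings *)

(* The part v m + s (resp. v m + s + s') is written (v, [:: s]) (resp.
   (v, [:: s; s'])); the order of s and s' accounts for the factor 2 of a part
   in B'. *)
Definition value (m : nat) (d : nat * seq nat) : nat := d.1 * m + sumn d.2.

Definition values (m : nat) : seq (nat * seq nat) -> seq nat := map (value m).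

Definition skeleton_of : seq (nat * seq nat) -> skeleton :=
  map (fun d => (d.1, size d.2)).

Definition word_of (x : seq (nat * seq nat)) : seq nat := flatten (unzip2 x).

Lemma all_word_of (a : pred nat) x : all a (word_of x) = all (fun d => all a d.2) x.
Proof. by elim: x => //= d x IH; rewrite /word_of /= all_cat -IH. Qed.

(** Rebuilds a decorated listing from its skeleton and its word, provided that the word has
    [letters c] letters. *)
Definition decorate (c : skeleton) (w : seq nat) : seq (nat * seq nat) :=
  zip (unzip1 c) (reshape (unzip2 c) w).

Lemma sumn_values m x :
  sumn (values m x) = levels (skeleton_of x) * m + sumn (word_of x).
Proof.
elim: x => //= d x IH; rewrite IH levels_cons /word_of /= sumn_cat /value.
by rewrite mulnDl; lia.
Qed.

Lemma letters_skeleton x : letters (skeleton_of x) = size (word_of x).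
Proof. by elim: x => //= d x IH; rewrite letters_cons IH size_cat. Qed.

Lemma decorateK x : decorate (skeleton_of x) (word_of x) = x.
Proof.
rewrite /decorate (_ : unzip2 _ = shape (unzip2 x)); last first.
  by rewrite /skeleton_of /shape /unzip2 -!map_comp.
by rewrite flattenK (_ : unzip1 _ = unzip1 x) ?zip_unzip // /skeleton_of /unzip1 -map_comp.
Qed.

Lemma word_of_decorate c w : letters c = size w -> word_of (decorate c w) = w.
Proof.
move=> cw; rewrite /word_of /decorate unzip2_zip ?reshapeKr //; first by rewrite -cw.
by rewrite size_reshape !size_map.
Qed.

Lemma skeleton_of_decorate c w : letters c = size w -> skeleton_of (decorate c w) = c.
Proof.
rewrite /letters /skeleton_of /decorate; elim: c w => //= -[u t] c IH w /= cw.
by rewrite IH ?size_drop -?cw ?addKn // size_takel // -cw leq_addr.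
Qed.

Fixpoint words (A : seq nat) (i : nat) : seq (seq nat) :=
  [::] :: if i is i'.+1 then [seq s :: w | s <- A, w <- words A i'] else [::].

Lemma mem_words (A : seq nat) i w : all [in A] w -> size w <= i -> w \in words A i.
Proof.
elim: i w => [|i IH] [|s w] //= /andP[sA wA] wi.
by rewrite inE /=; apply: allpairs_f => //; apply: IH.
Qed.

Definition decorated (m : nat) (S : {fset nat}) (K : pred skeleton) (n : nat)
    (x : seq (nat * seq nat)) : Prop :=
  [/\ K (skeleton_of x), all [in S] (word_of x) & sumn (values m x) = n].

(** The word w of a listing forces |w| letters and level sum (n - sum of w)/m in its skeleton, which
    is otherwise free in K. So the count depends on K through G only. Letters are positive, hence
    |w| <= n and [words S n] suffices as range. *)
Lemma has_card_decorated m (S : {fset nat}) (K : pred skeleton) (G : nat -> nat -> nat) n :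
    0 < m -> (forall s, s \in S -> 0 < s) ->
    (forall k N, has_card (fun c : skeleton => [/\ K c, letters c = k & levels c = N]) (G k N)) ->
  has_card (decorated m S K n)
    (\sum_(w <- [seq w <- undup (words S n) |
                  [&& all [in S] w, sumn w <= n & m %| n - sumn w]])
        G (size w) ((n - sumn w) %/ m)).
Proof.
move=> m0 S0 KG; set r := filter _ _.
pose P w x := [/\ K (skeleton_of x), word_of x = w & sumn (values m x) = n].
have := @has_card_sum _ _ r P (fun w => G (size w) ((n - sumn w) %/ m)).
case=> [|w w' x [_ <- _] [_ <- _] //|w|l ul [lP sl]].
- by rewrite filter_uniq // undup_uniq.
- rewrite mem_filter => /andP[/and3P[wS wn wm] _].
  apply: (has_card_image_in (g := fun c => decorate c w))
    (KG (size w) ((n - sumn w) %/ m)) => [c c' [_ cw _] [_ c'w _]|x].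
    by move/(congr1 skeleton_of); rewrite !skeleton_of_decorate.
  split=> [[xK xw xn]|[c [cK cw cN] ->]].
    exists (skeleton_of x); last by rewrite -xw decorateK.
    split=> //; first by rewrite letters_skeleton xw.
    by rewrite -xn sumn_values xw addnK mulnK.
  rewrite /P sumn_values skeleton_of_decorate // word_of_decorate //.
  by rewrite cN divnK // subnK.
exists l => //; split=> // x; rewrite lP; split=> [[w]|[xK xS xn]].
  by rewrite mem_filter => /andP[/and3P[wS _ _] _] [xK xw xn]; split=> //; rewrite xw.
exists (word_of x); last by split.
have xn' := xn; rewrite sumn_values in xn'.
rewrite mem_filter xS -xn' leq_addl addnK dvdn_mull //= mem_undup xn'.
apply: mem_words => //; rewrite -xn'; apply: leq_trans (leq_addl _ _).
elim: (word_of x) xS => //= s w IH /andP[/S0 s0 /IH]; lia.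
Qed.

(** The decorations of the parts are chosen independently. *)
Lemma has_card_lift m (okd : pred (nat * seq nat)) (f : nat -> nat) h :
    (forall y, y \in h -> has_card (fun d => okd d /\ value m d = y) (f y)) ->
  has_card (fun x => all okd x /\ values m x = h) (\prod_(y <- h) f y).
Proof.
elim: h => [|y h IH] hP.
  by rewrite big_nil; apply: (@has_card1 _ _ [::]) => -[|d x]; split=> // -[].
have ch : has_card (fun x => all okd x /\ values m x = h) (\prod_(z <- h) f z).
  by apply: IH => z zh; apply: hP; rewrite inE zh orbT.
rewrite big_cons; apply: eq_has_card (has_card_cons (hP y (mem_head _ _)) ch) => -[|d x].
  by split=> // -[].
split=> [[[dO <-] [xO <-]]|[/= /andP[dO xO] [dy xh]]] //=.
by rewrite dO xO.
Qed.

Lemma partition_inj n (p q : partition_of n) : perm_eq p q -> p = q.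
Proof.
move=> pq; apply: val_inj; apply: (@sorted_eq _ geq) pq.
- by move=> a b c ab bc; apply: leq_trans bc ab.
- by move=> a b; rewrite andbC => /anti_leq.
- by case/and3P: (partsP p).
- by case/and3P: (partsP q).
Qed.

Lemma partition_exists n (s : seq nat) : 0 \notin s -> sumn s = n ->
  exists p : partition_of n, perm_eq s p.
Proof.
move=> s0 sn; have sP : is_partition n (sort geq s).
  rewrite /is_partition sort_sorted; last by move=> a b; apply: leq_total.
  by rewrite mem_sort s0 (perm_sumn (permEl (perm_sort _ s))) sn /=.
by exists (Partition sP); rewrite /= perm_sym perm_sort.
Qed.

(* The listing of a partition is unique as R makes the levels strictly increase,
   so summing over the partitions in X sorts the decorated listings by their
   multiset of values. *)
Lemma has_card_listings m n (okd : pred (nat * seq nat)) (R : rel nat) (lev f : nat -> nat)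
    (X : {set partition_of n}) :
    (forall x y, R x y -> lev x < lev y) ->
    (forall d, okd d -> 0 < value m d) ->
    (forall d, okd d -> has_card (fun d' => okd d' /\ value m d' = value m d) (f (value m d))) ->
    (forall p, p \in X <-> exists h, [/\ perm_eq h p,
      {in h, forall y, exists2 d, okd d & value m d = y} & sorted R h]) ->
  has_card (fun x => [/\ all okd x, sorted R (values m x) & sumn (values m x) = n])
    (\sum_(p in X) \prod_(y <- p) f y).
Proof.
move=> Rlev pos card XP; rewrite -big_enum.
pose P (p : partition_of n) x :=
  [/\ all okd x, sorted R (values m x) & perm_eq (values m x) p].
apply: eq_has_card (has_card_sum (P := P) (enum_uniq _) _ _) => [x|p q x [_ _ xp] [_ _ xq]|p]; last 1 first.
- rewrite mem_enum => /XP[h [hp hO hR]].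
  rewrite -(perm_big _ hp).
  apply: eq_has_card (has_card_lift (m := m) (okd := okd) _) => [x|y yh]; last first.
    by have [d dO <-] := hO y yh; apply: card.
  split=> [[xO xh]|[xO xR xp]]; first by split=> //; rewrite xh.
  split=> //; apply: (@irr_sorted_eq _ (relpre lev ltn)).
  + by move=> a b c; apply: ltn_trans.
  + by move=> a; apply: ltnn.
  + by apply: sub_sorted xR.
  + by apply: sub_sorted hR.
  + by apply: perm_mem; rewrite (permPl xp) perm_sym.
- split=> [[p _ [xO xR xp]]|[xO xR xn]].
    by split=> //; rewrite (perm_sumn xp); case/and3P: (partsP p) => _ _ /eqP.
  have [|p xp] := @partition_exists n (values m x) _ xn.
    by apply/mapP => -[d /(allP xO) /pos + /esym d0]; rewrite d0.
  exists p => //; rewrite mem_enum; apply/XP; exists (values m x); split=> // y.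
  by case/mapP => d /(allP xO) dO ->; exists d.
- by apply: partition_inj; rewrite -(permPl xp).
Qed.

(** * Parts of A and H for a sum-free Sidon set *)

Section SumFreeSidon.
Variables (m : nat) (S : {fset nat}).
Hypotheses (m2 : 2 <= m) (Spos : forall s, s \in S -> 0 < s).
Hypotheses (Ssf : sum_free_mod m S) (Ssid : sidon_mod m S).

Definition okA (d : nat * seq nat) : bool := (size d.2 == 1) && all [in S] d.2.

Definition okH (d : nat * seq nat) : bool :=
  ((size d.2 == 1) || (size d.2 == 2) && (0 < d.1)) && all [in S] d.2.

Lemma okA_okH d : okA d -> okH d.
Proof. by rewrite /okH => /andP[-> ->]. Qed.

Lemma okH_pos d : okH d -> 0 < value m d.
Proof.
case: d => v [|s [|s' [|]]] //; rewrite /okH /value /=.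
  by case/andP=> /Spos; lia.
by case/and4P=> _ /Spos; lia.
Qed.

Lemma v_of_value d : okH d -> v_of m S (value m d) = d.1.
Proof.
move=> dO; apply: quoE; [lia|exact: incongruent_sumset2|].
case: d dO => v [|s [|s' [|]]] //; rewrite /okH in_fsetU /= addn0.
  by case/andP=> ->.
by case/and4P=> _ sS s'S _; apply/orP; right; apply/imfset2P; exists s => //; exists s'.
Qed.

Lemma u_of_value d : okA d -> u_of m S (value m d) = d.1.
Proof.
move=> dO; apply: quoE; [lia|exact: Ssf.1|].
by case: d dO => v [|s [|]] //; rewrite /okA /= addn0 => /andP[].
Qed.

(** The value determines the level, so the letters have equal sums. Sum-freeness separates one
    letter from two, and the Sidon property determines two letters up to order. *)
Lemma value_eq d d' : okH d -> okH d' -> value m d = value m d' ->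
  d.1 = d'.1 /\ (d.2 = d'.2 \/ d.2 = rev d'.2).
Proof.
move=> dO d'O E; have d1 : d.1 = d'.1 by rewrite -!v_of_value ?E.
split=> //; move: E; rewrite /value d1 => /addnI {d1}.
have [_ sf] := Ssf; have [_ sid] := Ssid.
case: d d' dO d'O => [u [|a [|b [|]]]] // [v [|c [|e [|]]]] //; rewrite /okH /=.
- by rewrite !addn0 => _ _ ->; left.
- case/andP=> aS _ /and4P[_ cS eS _] E; case: (sf c e a) => //.
  by congr (_ %% _); lia.
- case/and4P=> _ aS bS _ /andP[cS _] E; case: (sf a b c) => //.
  by congr (_ %% _); lia.
case/and4P=> _ aS bS _ /and4P[_ cS eS _] E.
have /sid-/(_ aS bS cS eS) F : a + b = c + e %[mod m] by congr (_ %% _); lia.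
have: a \in [fset c; e]%fset by rewrite -F !inE eqxx.
rewrite !inE => /orP[]/eqP ac; subst a; [left|right].
  by have -> : b = e by lia.
by have -> : b = c by lia.
Qed.

Lemma BsetP d : okH d -> Bset m S (value m d) <-> size d.2 = 2.
Proof.
move=> dO; split=> [[v [s [s' [v0 sS s'S E]]]]|d2].
  have d'O : okH (v, [:: s; s']) by rewrite /okH /= v0 sS s'S.
  have [|_ [->|->]] := value_eq dO d'O; rewrite ?size_rev //.
  by rewrite E /value /=; lia.
case: d dO d2 => v [|s [|s' [|]]] //; rewrite /okH /= => /and4P[v0 sS s'S _] _.
by exists v, s, s'; split=> //; rewrite /value /=; lia.
Qed.

Lemma AsetP y : Aset m S y <-> exists2 d, okA d & value m d = y.
Proof.
split=> [[u [s [sS ->]]]|[[u [|s [|]]] //]].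
  by exists (u, [:: s]); rewrite /okA /value /= ?sS ?addn0.
by rewrite /okA /= andbT => sS <-; exists u, s; rewrite /value /= addn0.
Qed.

Lemma HsetP y : Hset m S y <-> exists2 d, okH d & value m d = y.
Proof.
split=> [[/AsetP[d /okA_okH dO dy]|[v [s [s' [v0 sS s'S ->]]]]]|[d dO <-]].
- by exists d.
- by exists (v, [:: s; s']); rewrite /okH /value /= ?v0 ?sS ?s'S //; lia.
have [d2|d2] := eqVneq (size d.2) 2; first by right; apply/BsetP.
left; apply/AsetP; exists d => //.
by move: dO; rewrite /okH /okA (negbTE d2) orbF.
Qed.

Lemma has_card_okA d : okA d -> has_card (fun d' => okA d' /\ value m d' = value m d) 1.
Proof.
move=> dO; apply: (@has_card1 _ _ d) => d'; split=> [[d'O]|-> //].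
move/(value_eq (okA_okH d'O) (okA_okH dO)).
case: d d' dO d'O => [u [|a [|]]] // [v [|b [|]]] // _ _ [/= -> ].
by case=> [[->]|]; rewrite /rev /= => // -[->].
Qed.

(** The decorations of a value are [d] and its reversal, which differ exactly when [d] carries two
    distinct letters, that is, when the value lies in B'. *)
Lemma has_card_okH d : okH d ->
  has_card (fun d' => okH d' /\ value m d' = value m d) (2 ^ `[< B'set m S (value m d) >]).
Proof.
move=> dO; have dE d' : okH d' /\ value m d' = value m d <->
    d' = d \/ d' = (d.1, rev d.2).
  split=> [[d'O /(value_eq d'O dO)]|[->//|->]].
    by case: d d' {dO d'O} => [u w] [v w'] /= [-> []->]; [left|right].
  by rewrite /okH /value /= size_rev all_rev sumn_rev.
have [dr|dr] := eqVneq d.2 (rev d.2).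
  rewrite asboolF; last first.
    move=> [v [s [s' [v0 sS s'S ss' E]]]]; have d'O : okH (v, [:: s; s']).
      by rewrite /okH /= v0 sS s'S.
    have E' : value m d = value m (v, [:: s; s']) by rewrite E /value /=; lia.
    have [_ [] d2] := value_eq dO d'O E'; move: dr; rewrite d2 /rev /= => -[ss _].
      by rewrite ss eqxx in ss'.
    by rewrite ss eqxx in ss'.
  apply: (@has_card1 _ _ d) => d'; rewrite dE -dr -surjective_pairing.
  by split; [case|left].
rewrite asboolT.
  apply: eq_has_card (has_card_union _ (@has_card1 _ (eq^~ d) d _)
    (@has_card1 _ (eq^~ (d.1, rev d.2)) (d.1, rev d.2) _)) => // [d'|d' ->].
    by rewrite dE.
  by case: d dr {dO dE} => v w /= /eqP wr [].
case: d dO dr {dE} => v [|s [|s' [|]]] //; rewrite /okH /rev /= ?eqxx //.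
case/and4P=> v0 sS s'S _ ss'.
exists v, s, s'; split=> //; last by rewrite /value /=; lia.
by apply: contraNneq ss' => ->.
Qed.

Definition belowA (y x : nat) : bool := v_of m S y < v_of m S x.

(** Both gap conditions at once: the boolean adds 1 when the lower part [y] is in B. *)
Definition belowH (y x : nat) : bool :=
  v_of m S y + 3 + `[< Bset m S y >] <= v_of m S x.

Lemma decorated_skelA n x : decorated m S skelA n x <->
  [/\ all okA x, sorted belowA (values m x) & sumn (values m x) = n].
Proof.
have okE : all okA x = all (fun d => size d.2 == 1) x && all [in S] (word_of x).
  by rewrite all_word_of -all_predI.
rewrite /decorated /skelA /skel all_map.
have sE : all okA x -> sorted (gap gapA) (skeleton_of x) = sorted belowA (values m x).
  rewrite !sorted_map; apply: eq_in_sorted => d d' dO d'O.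
  by rewrite /= /gap /belowA !v_of_value ?okA_okH //= addn1.
split=> [[/andP[xt xs] xS xn]|[xO xs xn]].
  by have xO : all okA x; [rewrite okE xS andbT|rewrite -sE].
by move: (xO); rewrite okE => /andP[xt xS]; split=> //; rewrite sE // xs andbT.
Qed.

Lemma decorated_skelH n x : decorated m S skelH n x <->
  [/\ all okH x, sorted belowH (values m x) & sumn (values m x) = n].
Proof.
have okE : all okH x = all (fun d => (size d.2 == 1) || (size d.2 == 2) && (0 < d.1)) x
    && all [in S] (word_of x).
  by rewrite all_word_of -all_predI.
have tE : all (fun d : nat * seq nat => (size d.2 == 1) || (size d.2 == 2) && (0 < d.1)) x =
    all (fun y => single_or_pair y.2) (skeleton_of x)
    && all (fun y => (y.2 == 2) ==> (0 < y.1)) (skeleton_of x).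
  by rewrite !all_map -all_predI; apply: eq_all => -[u [|a [|b [|]]]].
rewrite /decorated /skelH /skel.
have sE : all okH x -> sorted (gap gapH) (skeleton_of x) = sorted belowH (values m x).
  rewrite !sorted_map; apply: eq_in_sorted => d d' dO d'O.
  (* By [BsetP], 3 plus the indicator of B equals the number of letters plus 2. *)
  rewrite /= /gap /belowH !v_of_value //= /gapH; congr (_ <= _).
  have [d2|d2] := eqVneq (size d.2) 2.
    by rewrite asboolT ?d2 ?addn1 ?addnS //; apply/BsetP.
  rewrite asboolF; last by move/(BsetP dO)/eqP; rewrite (negbTE d2).
  by case/andP: dO; rewrite (negbTE d2) orbF => /eqP -> _; rewrite addn0.
split=> [[/andP[/andP[xt xs] xp] xS xn]|[xO xs xn]].
  by have xO : all okH x; [rewrite okE xS andbT tE xt|rewrite -sE].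
move: (xO); rewrite okE tE => /andP[/andP[xt xp] xS]; split=> //.
by rewrite sE // xs xt xp.
Qed.

(** Listings in [calA] decrease while skeletons increase, hence the reversals. As u and v agree on
    A, the level is measured by v on both sides. *)
Lemma calA_listing n p : p \in calA m S n <-> exists h, [/\ perm_eq h p,
  {in h, forall y, exists2 d, okA d & value m d = y} & sorted belowA h].
Proof.
have uE y : Aset m S y -> u_of m S y = v_of m S y.
  by case/AsetP=> d dO <-; rewrite u_of_value // v_of_value // okA_okH.
rewrite inE; split=> [/asboolP[a [ap aA aS]]|[h [hp hO hS]]].
  exists (rev a); split; first by rewrite perm_rev.
    by move=> y; rewrite mem_rev => /aA /AsetP.
  rewrite rev_sorted; apply/(sortedP 0) => i ia; rewrite /belowA -!uE ?aS //.
    by apply/aA/mem_nth/ltnW.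
  by apply/aA/mem_nth.
apply/asboolP; exists (rev h); split; first by rewrite perm_rev.
  by move=> y; rewrite mem_rev => /hO /AsetP.
have /(sortedP 0) rS : sorted (fun y x => belowA x y) (rev h) by rewrite rev_sorted.
move=> i ih; rewrite !uE; first exact: rS.
  by apply/AsetP/hO; rewrite -mem_rev; apply/mem_nth/ltnW.
by apply/AsetP/hO; rewrite -mem_rev; apply/mem_nth.
Qed.

Lemma calH_listing n p : p \in calH m S n <-> exists h, [/\ perm_eq h p,
  {in h, forall y, exists2 d, okH d & value m d = y} & sorted belowH h].
Proof.
rewrite inE; split=> [/asboolP[a [ap aH a3 a4]]|[h [hp hO hS]]].
  exists (rev a); split; first by rewrite perm_rev.
    by move=> y; rewrite mem_rev => /aH /HsetP.
  rewrite rev_sorted; apply/(sortedP 0) => i ia; rewrite /belowH.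
  case: asboolP => [/(a4 i ia)|_]; first by rewrite -addnA.
  by rewrite addn0; apply: a3.
apply/asboolP; exists (rev h).
have /(sortedP 0) rS : sorted (fun y x => belowH x y) (rev h) by rewrite rev_sorted.
split=> [|y|i ih|i ih yB]; first by rewrite perm_rev.
- by rewrite mem_rev => /hO /HsetP.
- by apply: leq_trans (rS i ih); rewrite leq_addr.
- by apply: leq_trans (rS i ih); rewrite asboolT // -addnA.
Qed.

End SumFreeSidon.

Theorem theorem1 (m : nat) (S : {fset nat}) (n : nat)
    (hm : 2 <= m) (hS0 : S != fset0) (hSpos : forall s, s \in S -> 0 < s)
    (hSsf : sum_free_mod m S) (hSsid : sidon_mod m S) (hn : 0 < n) :
  pA m S n = \sum_(p in calH m S n) 2 ^ e' m S p.
Proof.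
have m0 : 0 < m by lia.
have cA : has_card (decorated m S skelA n) (pA m S n).
  apply: eq_has_card => [x|]; first exact: iff_sym (decorated_skelA hm hSsf hSsid n x).
  (* An element of A has one decoration, so every partition has weight 1, written as a product over
     its parts. *)
  rewrite /pA -sum1_card (eq_bigr (fun p : partition_of n => \prod_(y <- p) 1)).
    apply: (has_card_listings (lev := v_of m S)) => [x y //|d||p].
    - by move/okA_okH; apply: okH_pos.
    - by apply: has_card_okA.
    - exact: calA_listing.
  by move=> p _; rewrite big1.
have cH : has_card (decorated m S skelH n) (\sum_(p in calH m S n) 2 ^ e' m S p).
  apply: eq_has_card => [x|]; first exact: iff_sym (decorated_skelH hm hSsf hSsid n x).
  (* The weight 2^e' is a product over the parts, with a factor 2 for each part in B', its number of
     decorations. *)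
  rewrite (eq_bigr (fun p : partition_of n => \prod_(y <- p) 2 ^ `[< B'set m S y >])).
    apply: (has_card_listings (lev := v_of m S)) => [x y|d||p].
    - by rewrite /belowH; lia.
    - exact: okH_pos.
    - by apply: has_card_okH.
    - exact: calH_listing.
  by move=> p _; rewrite -expn_sum /e' -sum1_count big_mkcond.
(* Both families of skeletons are counted by [gcoef], so both sides equal the same sum over
   words. *)
have gA := has_card_decorated n m0 hSpos has_card_skelA.
have gH := has_card_decorated n m0 hSpos has_card_skelH.
by rewrite (has_card_fun cA gA) (has_card_fun cH gH).
Qed.
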